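(* Let $(X,+)$ be an abelian Polish group and let $\mathcal{I}$ be a $\sigma$-ideal on $X$ that contains all singletons and has a Borel base. The following are equivalent: (i) $\mathcal{I}$ has the Very Weak Smital Property (VWSP); (ii) $\mathcal{I}$ is maximal among invariant proper $\sigma$-ideals with Borel base.
   Context: A $\sigma$-ideal $\mathcal{K}$ on $X$ is proper if $X\notin\mathcal{K}$, invariant if $A+x\in\mathcal{K}$ for all $A\in\mathcal{K}$, $x\in X$, and has a Borel base if every member of $\mathcal{K}$ is contained in a Borel member of $\mathcal{K}$. Maximality is with respect to inclusion. $A+D=\{a+d:a\in A,d\in D\}$. VWSP: for every Borel set $A\notin\mathcal{I}$ there is a countable set $D$ such that $A+D$ is $\mathcal{I}$-residual, i.e. the complement of $A+D$ belongs to $\mathcal{I}$.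
   Formalization: The σ-ideal I is additionally assumed proper and invariant; without this (i)⇒(ii) fails, e.g. for I = all subsets of X, or on the reals for I = {A : A∩[0,1] is Lebesgue null}. *)

(* Defs.v *)
From mathcomp Require Import all_boot all_order all_algebra.
From mathcomp Require Import all_classical all_reals all_analysis.

Set Implicit Arguments.
Unset Strict Implicit.
Unset Printing Implicit Defensive.

Import Order.TTheory GRing.Theory Num.Theory.

Local Open Scope classical_set_scope.
Local Open Scope ring_scope.

Section polish.
Context (R : realType) (X : topologicalType).

Definition is_metric (d : X -> X -> R) :=
  [/\ forall x y, 0 <= d x y,
      forall x y, d x y = 0 <-> x = y,
      forall x y, d x y = d y x &
      forall x y z, d x z <= d x y + d y z].

Definition induces_topology (d : X -> X -> R) :=
  forall (x : X) (A : set X),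
    nbhs x A <-> exists2 e : R, 0 < e & [set y | d x y < e] `<=` A.

Definition cauchy_seq (d : X -> X -> R) (u : nat -> X) :=
  forall e : R, 0 < e ->
    exists N : nat, forall m n : nat,
      (N <= m)%N -> (N <= n)%N -> d (u m) (u n) < e.

Definition complete_metric (d : X -> X -> R) :=
  forall u : nat -> X, cauchy_seq d u -> exists l : X, u @ \oo --> l.

(* The metric is not required to be translation-invariant, even when [X] is a
   topological group: this is Polishness of the underlying space. *)
Definition completely_metrizable :=
  exists d : X -> X -> R,
    [/\ is_metric d, induces_topology d & complete_metric d].

Definition separable_space := exists2 D : set X, countable D & dense D.

Definition polish := separable_space /\ completely_metrizable.

End polish.

Section ideals.
Context (X : topologicalZmodType).
Implicit Types (A D : set X) (I K : set (set X)).

Definition borel : set (set X) := <<s [set U : set X | open U] >>.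

Definition sumset A D : set X := [set a + d | a in A & d in D].

Definition translate A (x : X) : set X := [set a + x | a in A].

Definition sigma_ideal K :=
  [/\ K set0,
      forall A B : set X, A `<=` B -> K B -> K A &
      forall F : nat -> set X, (forall n, K (F n)) -> K (\bigcup_n F n)].

Definition proper_sigma_ideal K := ~ K setT.

Definition invariant_sigma_ideal K := forall A (x : X), K A -> K (translate A x).

Definition borel_base K :=
  forall A, K A -> exists B : set X, [/\ borel B, K B & A `<=` B].

Definition contains_singletons K := forall x : X, K [set x].

Definition residual I A := I (~` A).

Definition VWSP I :=
  forall A, borel A -> ~ I A ->
    exists2 D : set X, countable D & residual I (sumset A D).

Definition inv_proper_borel_ideal K :=
  [/\ sigma_ideal K, invariant_sigma_ideal K, proper_sigma_ideal K & borel_base K].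

Definition maximal_inv_proper_borel_ideal I :=
  inv_proper_borel_ideal I /\
  forall K, inv_proper_borel_ideal K -> I `<=` K -> K = I.

End ideals.

(* Main.v *)
Require Import Defs.
From mathcomp Require Import all_boot all_order all_algebra.
From mathcomp Require Import all_classical all_reals all_analysis.

(** If [I] has the Very Weak Smital Property and [K] is an invariant
    sigma-ideal with Borel base strictly above [I], then [K] contains a Borel
    set [B] outside [I], hence it contains every countable union of translates
    of [B]; by the property one of these is [I]-residual, so [K] contains the
    whole space and is not proper.

    Conversely, given a Borel set [A] outside a maximal [I], adjoin [A] to [I]:
    the sets covered by [(A + D) `|` E], with [D] countable and [E] in [I],
    form an invariant sigma-ideal with Borel base which strictly contains [I].
    By maximality it is not proper, so [(A + D) `|` E] is the whole space for
    some [D] and [E]; then the complement of [A + D] lies in [E], that is, [A]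
    satisfies the property.

    Both halves rest on [A + D] being the union of the translates of [A] by the
    points of [D] ([sumset_bigcup]), which puts it in every invariant
    sigma-ideal containing [A] ([sumset_ideal]) and makes it Borel when [A] is
    ([borel_sumset]). *)

Import GRing.Theory.
Local Open Scope classical_set_scope.
Local Open Scope ring_scope.

(** Common to ideals and to the Borel sets, which are both closed under unions
    of sequences and contain [set0]. *)
Lemma countable_bigcup_closed {T U : Type} (P : set (set T)) (D : set U)
    (F : U -> set T) :
  P set0 -> (forall G : nat -> set T, (forall n, P (G n)) -> P (\bigcup_n G n)) ->
  countable D -> (forall d, D d -> P (F d)) -> P (\bigcup_(d in D) F d).
Proof.
move=> P0 Pcup /countable_injP[f finj] PF.
(* By injectivity of [f] on [D], the fibre over [n] is empty or a single
   [F d]. *)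
have -> : \bigcup_(d in D) F d =
    \bigcup_n \bigcup_(d in [set d | D d /\ f d = n]) F d.
  apply/seteqP; split=> [x [d Dd Fx]|x [n _ [d [Dd _] Fx]]].
    by exists (f d) => //; exists d.
  by exists d.
apply: Pcup => n.
have [[d [Dd fd]]|noD] := pselect (exists d, D d /\ f d = n); last first.
  by rewrite bigcup0 // => d Dd; case: noD; exists d.
suff -> : [set d' | D d' /\ f d' = n] = [set d].
  by rewrite bigcup_set1; exact: PF.
apply/seteqP; split=> [d' [Dd' fd']|d' ->] //=.
by apply: finj; rewrite ?inE // fd' fd.
Qed.

Section Sumset.
Context {X : topologicalZmodType}.
Implicit Types (A B D : set X) (K : set (set X)).

Lemma translate_preimage A (x : X) : translate A x = (fun y => y - x) @^-1` A.
Proof.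
apply/seteqP; split=> [y [a Aa <-]|y Ay] /=; first by rewrite addrK.
by exists (y - x); rewrite // subrK.
Qed.

Lemma sumset_bigcup A D : sumset A D = \bigcup_(d in D) translate A d.
Proof.
apply/seteqP; split=> [y [a Aa [d Dd <-]]|y [d Dd [a Aa <-]]].
  by exists d => //; exists a.
by exists a => //; exists d.
Qed.

Lemma translate_sumset A D (x : X) :
  translate (sumset A D) x = sumset A (translate D x).
Proof.
apply/seteqP; split=> [y [_ [a Aa [d Dd <-]] <-]|y [a Aa [_ [d Dd <-] <-]]].
  by exists a => //; exists (d + x); [exists d|rewrite addrA].
by exists (a + d); [exists a => //; exists d|rewrite addrA].
Qed.

Lemma borel_continuous_preimage (f : X -> X) B :
  continuous f -> borel B -> borel (f @^-1` B).
Proof.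
move=> fc; have [b0 bC bU] : sigma_algebra setT (@borel X).
  exact: smallest_sigma_algebra.
apply: (@smallest_sub _ (sigma_algebra setT) _ [set B | borel (f @^-1` B)]).
  split=> [|C /= bf|F bF] /=; first by rewrite preimage_set0.
    by rewrite -[X in borel X]/(setT `\` f @^-1` C); exact: bC.
  by rewrite preimage_bigcup; exact: bU.
by move=> U oU; apply: sub_gen_smallest; apply: open_comp => // x _; exact: fc.
Qed.

Lemma borel_translate A (x : X) : borel A -> borel (translate A x).
Proof.
rewrite translate_preimage; apply: borel_continuous_preimage => y.
apply: (@continuous_comp _ _ _ (fun y => (y, x)) (fun z : X * X => z.1 - z.2)).
  by apply: cvg_pair; [exact: cvg_id|exact: cvg_cst].
exact: sub_continuous.
Qed.

Lemma borelU A B : borel A -> borel B -> borel (A `|` B).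
Proof.
have [b0 _ bU] : sigma_algebra setT (@borel X).
  exact: smallest_sigma_algebra.
move=> bA bB; rewrite -bigcup2E; apply: bU => -[|[|n]] //=.
Qed.

Lemma borel_sumset A D : borel A -> countable D -> borel (sumset A D).
Proof.
have [b0 _ bU] : sigma_algebra setT (@borel X).
  exact: smallest_sigma_algebra.
move=> bA cD; rewrite sumset_bigcup.
by apply: countable_bigcup_closed => // d _; exact: borel_translate.
Qed.

Lemma sigma_idealU {K A B} : sigma_ideal K -> K A -> K B -> K (A `|` B).
Proof.
by case=> K0 _ KU KA KB; rewrite -bigcup2E; apply: KU => -[|[|n]].
Qed.

Lemma sumset_ideal K A D : sigma_ideal K -> invariant_sigma_ideal K ->
  countable D -> K A -> K (sumset A D).
Proof.
move=> [K0 _ KU] Kinv cD KA; rewrite sumset_bigcup.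
by apply: countable_bigcup_closed => // d _; exact: Kinv.
Qed.

End Sumset.

Section Adjoin.
Context {X : topologicalZmodType} (I : set (set X)) (A : set X).

(** When [I] is an invariant sigma-ideal, this is the least one containing both
    [I] and [A]: countable unions and translations of sets [A + D] only change
    the countable set [D]. *)
Definition adjoin_ideal : set (set X) :=
  [set C | exists D E : set X,
    [/\ countable D, I E & C `<=` sumset A D `|` E]].

Lemma adjoin_sub : I `<=` adjoin_ideal.
Proof. by move=> E IE; exists set0, E; split=> // x; right. Qed.

Lemma adjoin_mem : I set0 -> adjoin_ideal A.
Proof.
move=> I0; exists [set 0], set0; split=> // a Aa; left.
by exists a => //; exists 0; rewrite ?addr0.
Qed.

Lemma adjoin_sigma_ideal : sigma_ideal I -> sigma_ideal adjoin_ideal.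
Proof.
move=> [I0 _ IU]; split; first exact: adjoin_sub.
  by move=> B C BC [D [E [cD IE CDE]]]; exists D, E; split=> // x /BC/CDE.
move=> F /(_ _)/cid FDE.
pose D n := projT1 (FDE n); pose E n := projT1 (cid (projT2 (FDE n))).
have DE n : [/\ countable (D n), I (E n) & F n `<=` sumset A (D n) `|` E n].
  by rewrite /E; case: cid.
exists (\bigcup_n D n), (\bigcup_n E n); split.
- by apply: bigcup_countable => // n _; have [] := DE n.
- by apply: IU => n; have [] := DE n.
- move=> x [n _ Fx]; have [_ _ /(_ x Fx)] := DE n.
  case=> [[a Aa [d Dd <-]]|Ex]; last by right; exists n.
  by left; exists a => //; exists d => //; exists n.
Qed.

Lemma adjoin_invariant :
  invariant_sigma_ideal I -> invariant_sigma_ideal adjoin_ideal.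
Proof.
move=> Iinv C x [D [E [cD IE CDE]]].
exists (translate D x), (translate E x); split.
- exact: (sub_countable (card_image_le _ _)).
- exact: Iinv IE.
- move=> _ [c /CDE DEc <-]; rewrite -translate_sumset.
  by case: DEc => DEc; [left|right]; exists c.
Qed.

Lemma adjoin_borel_base : borel A -> borel_base I -> borel_base adjoin_ideal.
Proof.
move=> bA Ibase C [D [E [cD IE CDE]]].
have [B [bB IB EB]] := Ibase E IE.
exists (sumset A D `|` B); split.
- by apply: borelU => //; exact: borel_sumset.
- by exists D, B; split.
- by move=> x /CDE[?|/EB ?]; [left|right].
Qed.

End Adjoin.

Lemma VWSP_maximal {X : topologicalZmodType} (I K : set (set X)) :
  sigma_ideal I -> VWSP I -> inv_proper_borel_ideal K -> I `<=` K -> K = I.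
Proof.
move=> [_ Isub _] Ivwsp [Ksigma Kinv Kproper Kbase] IK.
apply/seteqP; split=> // A /Kbase[B [bB KB AB]]; apply: (Isub _ _ AB).
apply: contrapT => /(Ivwsp B bB)[D cD /IK KD].
apply: Kproper; rewrite -(setUv (sumset B D)).
by apply: sigma_idealU => //; exact: sumset_ideal.
Qed.

Lemma maximal_VWSP {X : topologicalZmodType} (I : set (set X)) :
  maximal_inv_proper_borel_ideal I -> VWSP I.
Proof.
move=> [[Isigma Iinv _ Ibase] Imax] A bA nIA; have [I0 Isub _] := Isigma.
have [[D [E [cD IE DE]]]|proper] := pselect (adjoin_ideal I A setT).
  exists D => //; apply: (Isub _ _ _ IE) => x nDx.
  by have [|] := DE x Logic.I.
case: nIA; rewrite -(Imax (adjoin_ideal I A)).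
- exact: adjoin_mem.
- split=> //; first exact: adjoin_sigma_ideal.
    exact: adjoin_invariant.
  exact: adjoin_borel_base.
- exact: adjoin_sub.
Qed.

Theorem proposition25 (R : realType) (X : topologicalZmodType)
    (I : set (set X))
    (Xpolish : polish R X)
    (Isigma : sigma_ideal I)
    (Iproper : proper_sigma_ideal I)
    (Iinvariant : invariant_sigma_ideal I)
    (Isingletons : contains_singletons I)
    (Iborel : borel_base I) :
  VWSP I <-> maximal_inv_proper_borel_ideal I.
Proof.
split=> [Ivwsp|]; last exact: maximal_VWSP.
by split=> // K; exact: VWSP_maximal.
Qed.
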